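(* Let $f$ be a smooth real function and let $R_2(u,v)=(u\sinh v,\,u\cosh v,\,f(u))$ be the rotational surface with time-like meridians in the pseudo-isotropic space $\mathbb{I}_p^3$. The space-like loxodromes on $R_2$ (with constant pseudo-isotropic angle $\eta$ to the meridians) are $$\gamma_3(t)=\bigl(\pm t\sinh\eta\,\sinh(\pm\coth\eta\,\ln|t|),\ \pm t\sinh\eta\,\cosh(\pm\coth\eta\,\ln|t|),\ f(\pm t\sinh\eta)\bigr),$$ where $\eta\in\mathbb{R}^+\cup\{0\}$.
   Context: Pseudo-isotropic space $\mathbb{I}_p^3$ is $\mathbb{R}^3$ with coordinates $(x,y,z)$ and the pseudo-isotropic scalar product, for $p=(p_1,p_2,p_3)$ and $q=(q_1,q_2,q_3)$: $\langle p,q\rangle=p_3q_3$ if $p_1=p_2=0$ and $q_1=q_2=0$, and $\langle p,q\rangle=p_1q_1-p_2q_2$ otherwise. A vector $(0,0,p_3)$ is called isotropic; other vectors are non-isotropic. A non-isotropic vector $p$ is space-like if $\langle p,p\rangle>0$ (the zero vector is also counted as space-like), time-like if $\langle p,p\rangle<0$, light-like if $\langle p,p\rangle=0$ and $p\neq0$; a curve is space-like (time-like) if its velocity vectors are. Put $\|p\|=\sqrt{|\langle p,p\rangle|}$. The surface $R_2$ is obtained by applying the hyperbolic rotations $(x,y,z)\mapsto(x\cosh v+y\sinh v,\ x\sinh v+y\cosh v,\ z)$, $v\in\mathbb{R}$, to the time-like profile curve $\alpha_2(u)=(0,u,f(u))$. Its induced metric is $ds^2=-du^2+u^2dv^2$.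 Its meridians are the curves $\beta_v(u)=R_2(u,v)$ with $v$ constant; they are time-like. The pseudo-isotropic angle $\eta\in\mathbb{R}^+\cup\{0\}$ between a space-like non-isotropic vector $p$ and a time-like non-isotropic vector $q$ is given by $|\langle p,q\rangle|=\|p\|\,\|q\|\sinh\eta$. A loxodrome is a curve on the rotational surface which cuts all meridians at a constant angle, i.e. the angle between its velocity vector at each of its points and the meridian's tangent vector $\beta_v'$ at that point is constant. In the formula, the curve is $\gamma_3(t)=R_2(u(t),v(t))$ with $u(t)=\pm t\sinh\eta$ and $v(t)=\pm\coth\eta\,\ln|t|$, the sign of $u$ being the same in all three components and the sign of $v$ the same in both components where it occurs.
   Formalization: The formula is asserted for η>0 only, as coth 0 is undefined; for η=0 the loxodromes are shown to be the parallels u=u₀≠0. Conversely, each loxodrome is γ₃ up to a hyperbolic rotation (the integration constant of v) and reparametrization by arc length. *)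

(* Defs.v *)
From Stdlib Require Import Reals Lra.
From Coquelicot Require Import Coquelicot.
Open Scope R_scope.

Definition vec : Type := (R * R * R)%type.
Definition cx (p : vec) : R := fst (fst p).
Definition cy (p : vec) : R := snd (fst p).
Definition cz (p : vec) : R := snd p.

Definition isotropic (p : vec) : Prop := cx p = 0 /\ cy p = 0.

Definition isotropic_dec (p : vec) : {isotropic p} + {~ isotropic p}.
Proof.
unfold isotropic.
destruct (Req_EM_T (cx p) 0) as [hx | hx].
- destruct (Req_EM_T (cy p) 0) as [hy | hy].
  + left; split; assumption.
  + right; intros [_ h]; exact (hy h).
- right; intros [h _]; exact (hx h).
Defined.

Definition pscal (p q : vec) : R :=
  match isotropic_dec p, isotropic_dec q with
  | left _, left _ => cz p * cz q
  | _, _ => cx p * cx q - cy p * cy q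
  end.

Definition pnorm (p : vec) : R := sqrt (Rabs (pscal p p)).

Definition spacelike (p : vec) : Prop :=
  p = (0, 0, 0) \/ (~ isotropic p /\ 0 < pscal p p).

Definition timelike (p : vec) : Prop := ~ isotropic p /\ pscal p p < 0.

(* A relation rather than a function: the angle is only defined between a
   space-like non-isotropic vector [p] (so [p] is not zero) and a time-like
   vector [q]; it is unique because [sinh] is injective. *)
Definition is_angle (p q : vec) (eta : R) : Prop :=
  spacelike p /\ ~ isotropic p /\ timelike q /\
  0 <= eta /\ Rabs (pscal p q) = pnorm p * pnorm q * sinh eta.

Definition in_ival (a b : Rbar) (t : R) : Prop :=
  Rbar_lt a (Finite t) /\ Rbar_lt (Finite t) b.

Definition smooth_on (a b : Rbar) (g : R -> R) : Prop :=
  forall (n : nat) (t : R), in_ival a b t -> ex_derive_n g n t.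

Definition smooth (g : R -> R) : Prop := smooth_on m_infty p_infty g.

(* [Derive] is total; the curves below are smooth wherever this is used. *)
Definition velocity (g : R -> vec) (t : R) : vec :=
  (Derive (fun s => cx (g s)) t,
   Derive (fun s => cy (g s)) t,
   Derive (fun s => cz (g s)) t).

Definition hyp_rot (v : R) (p : vec) : vec :=
  (cx p * cosh v + cy p * sinh v, cx p * sinh v + cy p * cosh v, cz p).

Definition profile (f : R -> R) (u : R) : vec := (0, u, f u).

Definition R2 (f : R -> R) (u v : R) : vec := (u * sinh v, u * cosh v, f u).

Lemma R2_hyp_rot (f : R -> R) (u v : R) : R2 f u v = hyp_rot v (profile f u).
Proof.
unfold R2, hyp_rot, profile, cx, cy, cz; simpl.
now rewrite !Rmult_0_l, !Rplus_0_l.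
Qed.

Definition meridian (f : R -> R) (v u : R) : vec := R2 f u v.

Definition spacelike_curve (a b : Rbar) (g : R -> vec) : Prop :=
  forall t, in_ival a b t -> spacelike (velocity g t).

Definition loxodrome (f : R -> R) (eta : R) (a b : Rbar) (g : R -> vec) : Prop :=
  exists u v : R -> R,
    smooth_on a b u /\ smooth_on a b v /\
    (forall t, in_ival a b t -> g t = R2 f (u t) (v t)) /\
    (forall t, in_ival a b t ->
       is_angle (velocity g t) (velocity (meridian f (v t)) (u t)) eta).

Definition spacelike_loxodrome (f : R -> R) (eta : R) (a b : Rbar)
    (g : R -> vec) : Prop :=
  spacelike_curve a b g /\ loxodrome f eta a b g.

Definition coth (x : R) : R := cosh x / sinh x.

Definition is_sign (e : R) : Prop := e = 1 \/ e = -1.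

Definition gamma3 (f : R -> R) (eta e1 e2 t : R) : vec :=
  (e1 * t * sinh eta * sinh (e2 * coth eta * ln (Rabs t)),
   e1 * t * sinh eta * cosh (e2 * coth eta * ln (Rabs t)),
   f (e1 * t * sinh eta)).

(* The parallel at height [u0], parametrized by arc length.  For [eta = 0],
   where [coth eta] is undefined, the parallels take the place of [gamma3]. *)
Definition parallel (f : R -> R) (u0 t : R) : vec := R2 f u0 (t / u0).

(* [phi] is a (signed) arc length along [g], hence a regular change of
   parameter. *)
Definition arclength (a b : Rbar) (g : R -> vec) (phi : R -> R) : Prop :=
  smooth_on a b phi /\
  (forall t, in_ival a b t ->
     Derive phi t <> 0 /\ Rabs (Derive phi t) = pnorm (velocity g t)).

(* Main.v *)
(** Along [g = R2 (u, v)] the first fundamental form is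
    [u^2 v'^2 - u'^2] and the product of [g'] with the meridian tangent is
    [- u'].  So [g] is space-like and makes the angle [eta] with the meridians
    iff [u v' <> 0] and [|u'| cosh eta = |u v'| sinh eta], and then
    [|g'| sinh eta = |u'|] and [|g'| cosh eta = |u v'|].  For [eta > 0] neither
    [u] nor [u'] vanishes, the sign of [v' / (u' / u) = +- coth eta] is constant
    on the interval, and integrating gives [v = +- coth eta ln |u| + const]; the
    arc length is [u / sinh eta].  For [eta = 0], [u] is a constant [u0] and the
    arc length is [u0 v]. *)
Require Import Defs.
From Stdlib Require Import Reals Lra.
From Coquelicot Require Import Coquelicot.
Open Scope R_scope.

(** * Hyperbolic functions *)

Lemma cosh2_sinh2 (x : R) : cosh x * cosh x = 1 + sinh x * sinh x.
Proof.
  assert (H : exp x * exp (- x) = 1).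
  { rewrite <- exp_plus, Rplus_opp_r; apply exp_0. }
  unfold cosh, sinh; nra.
Qed.

Lemma cosh_pos (x : R) : 0 < cosh x.
Proof.
  unfold cosh; pose proof (exp_pos x); pose proof (exp_pos (- x)); lra.
Qed.

Lemma sinh_pos (x : R) : 0 < x -> 0 < sinh x.
Proof. intros Hx; rewrite <- sinh_0; now apply sinh_lt. Qed.

Lemma sinh_nonneg (x : R) : 0 <= x -> 0 <= sinh x.
Proof.
  intros [Hx | <-]; [left; now apply sinh_pos | rewrite sinh_0; lra].
Qed.

Lemma cosh_plus (x y : R) :
  cosh (x + y) = cosh x * cosh y + sinh x * sinh y.
Proof.
  unfold cosh, sinh; rewrite Ropp_plus_distr, !exp_plus; field.
Qed.

Lemma sinh_plus (x y : R) :
  sinh (x + y) = sinh x * cosh y + cosh x * sinh y.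
Proof.
  unfold cosh, sinh; rewrite Ropp_plus_distr, !exp_plus; field.
Qed.

(** By the addition theorems. It turns the integration constant of [v] into the rotation by [c] in
    the classification. *)
Lemma hyp_rot_R2 (f : R -> R) (c u v : R) :
  hyp_rot c (R2 f u v) = R2 f u (c + v).
Proof.
  unfold hyp_rot, R2, cx, cy, cz; simpl.
  rewrite cosh_plus, sinh_plus.
  f_equal; f_equal; ring.
Qed.

(** * Real functions on an open interval *)

Lemma in_ival_locally (a b : Rbar) (t : R) :
  in_ival a b t -> locally t (in_ival a b).
Proof.
  intros [Ha Hb]; apply filter_and.
  - exact (open_Rbar_gt a t Ha).
  - exact (open_Rbar_lt b t Hb).
Qed.

Lemma in_ival_between (a b : Rbar) (x y t : R) :
  in_ival a b x -> in_ival a b y -> x <= t <= y -> in_ival a b t.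
Proof.
  unfold in_ival; destruct a, b; simpl; intuition lra.
Qed.

Lemma in_ival_nonempty (a b : Rbar) :
  Rbar_lt a b -> exists t, in_ival a b t.
Proof.
  unfold in_ival; destruct a as [a | |], b as [b | |]; simpl; intros H;
    try easy.
  - exists ((a + b) / 2); lra.
  - exists (a + 1); lra.
  - exists (b - 1); lra.
  - now exists 0.
Qed.

Lemma is_derive_zero_constant (a b : Rbar) (h : R -> R) (x y : R) :
  (forall t, in_ival a b t -> is_derive h t 0) ->
  in_ival a b x -> in_ival a b y -> h x = h y.
Proof.
  intros Hh Hx Hy.
  assert (Hlt : forall x y, in_ival a b x -> in_ival a b y -> x < y -> h x = h y).
  { intros x' y' Hx' Hy' L; apply (eq_is_derive h); trivial; intros t Ht.
    apply Hh, (in_ival_between a b x' y'); assumption. }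
  destruct (Rtotal_order x y) as [L | [-> | L]]; auto.
  symmetry; auto.
Qed.

(** A change of sign would produce a zero by the intermediate value theorem. *)
Lemma nonvanishing_sign (a b : Rbar) (h : R -> R) :
  Rbar_lt a b ->
  (forall t, in_ival a b t -> continuity_pt h t /\ h t <> 0) ->
  exists e, is_sign e /\ forall t, in_ival a b t -> 0 < e * h t.
Proof.
  intros Hab Hh.
  (* [IVT_interv] wants the negative value on the left; otherwise use [- h]. *)
  assert (Hsame : forall x y, in_ival a b x -> in_ival a b y ->
                    h x < 0 -> 0 < h y -> False).
  { intros x y Hx Hy Nx Py.
    destruct (Rtotal_order x y) as [L | [-> | L]]; [| lra |].
    - destruct (Ranalysis5.IVT_interv h x y) as [z [Hz Ez]]; trivial.
      + intros t Ht; apply Hh, (in_ival_between a b x y); assumption.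
      + apply (proj2 (Hh z (in_ival_between a b x y z Hx Hy Hz))), Ez.
    - destruct (Ranalysis5.IVT_interv (fun t => - h t) y x) as [z [Hz Ez]];
        trivial; try lra.
      + intros t Ht; apply continuity_pt_opp, Hh.
        apply (in_ival_between a b y x); assumption.
      + apply (proj2 (Hh z (in_ival_between a b y x z Hy Hx Hz))); lra. }
  destruct (in_ival_nonempty a b Hab) as [t0 H0].
  destruct (Rdichotomy _ _ (proj2 (Hh t0 H0))) as [N | P].
  - exists (-1); split; [now right |]; intros t Ht.
    destruct (Rdichotomy _ _ (proj2 (Hh t Ht))) as [|Q]; [lra |].
    destruct (Hsame t0 t H0 Ht N Q).
  - exists 1; split; [now left |]; intros t Ht.
    destruct (Rdichotomy _ _ (proj2 (Hh t Ht))) as [Q|]; [| lra].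
    destruct (Hsame t t0 Ht H0 Q P).
Qed.

(** * Smoothness of the coordinate functions *)

Lemma smooth_on_ex_derive (a b : Rbar) (h : R -> R) (t : R) :
  smooth_on a b h -> in_ival a b t -> ex_derive h t.
Proof. intros Hh Ht; exact (Hh 1%nat t Ht). Qed.

Lemma smooth_on_continuity_Derive (a b : Rbar) (h : R -> R) (t : R) :
  smooth_on a b h -> in_ival a b t -> continuity_pt (Derive h) t.
Proof.
  intros Hh Ht; apply continuity_pt_filterlim.
  exact (ex_derive_continuous (Derive h) t (Hh 2%nat t Ht)).
Qed.

(** From the first derivative on, the derivatives are those of the constant 1 with the order lowered
    by one. *)
Lemma ex_derive_n_id (n : nat) (t : R) : ex_derive_n (fun x => x) n t.
Proof.
  destruct n as [| n]; [exact I |].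
  assert (H : forall m x,
             Derive_n (fun x => x) (S m) x = Derive_n (fun _ => 1) m x).
  { induction m as [| m IH]; intros x; [apply Derive_id |].
    simpl; apply Derive_ext, IH. }
  destruct n as [| n]; [apply ex_derive_id |].
  apply ex_derive_ext with (Derive_n (fun _ => 1) n).
  - intros x; symmetry; apply H.
  - exact (ex_derive_n_const 1 (S n) t).
Qed.

Lemma is_derive_ln_Rabs (x : R) :
  x <> 0 -> is_derive (fun t => ln (Rabs t)) x (/ x).
Proof.
  intros Hx.
  (* This is the form in which the chain rule delivers the derivative. *)
  replace (/ x) with (sign x * 1 * / Rabs x).
  - apply (is_derive_comp ln Rabs).
    + now apply is_derive_ln, Rabs_pos_lt.
    + apply (is_derive_Rabs (fun t => t)); [apply (is_derive_id x) | exact Hx].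
  - destruct (Rdichotomy _ _ Hx) as [H | H].
    + rewrite sign_eq_m1, Rabs_left by exact H; field; lra.
    + rewrite sign_eq_1, Rabs_right by lra; field; lra.
Qed.

Lemma Derive_ln_Rabs (x : R) :
  x <> 0 -> Derive (fun t => ln (Rabs t)) x = / x.
Proof. intros Hx; now apply is_derive_unique, is_derive_ln_Rabs. Qed.

(** Off the origin the derivative of order [m + 1] is [c / x ^ (m + 1)] for a constant [c]. As this
    formula fails at 0, it is differentiated through equality on a neighbourhood of [x]. *)
Lemma ex_derive_n_ln_Rabs (n : nat) (x : R) :
  x <> 0 -> ex_derive_n (fun t => ln (Rabs t)) n x.
Proof.
  assert (Hloc : forall x : R, x <> 0 -> locally x (fun t => t <> 0)).
  { exact (open_neq 0). }
  assert (H : forall m, exists c, forall x, x <> 0 ->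
             Derive_n (fun t => ln (Rabs t)) (S m) x = c * / x ^ S m).
  { induction m as [| m [c IH]].
    - exists 1; intros y Hy; simpl.
      rewrite Derive_ln_Rabs by exact Hy; now field.
    - exists (- INR (S m) * c); intros y Hy.
      change (Derive (Derive_n (fun t => ln (Rabs t)) (S m)) y
              = - INR (S m) * c * / y ^ S (S m)).
      rewrite (Derive_ext_loc _ (fun t => c * / t ^ S m)).
      + apply is_derive_unique; auto_derive.
        * now apply (pow_nonzero y (S m)).
        * change (match m with 0%nat => 1 | S _ => INR m + 1 end)
            with (INR (S m)).
          simpl; field; split; trivial; now apply pow_nonzero.
      + generalize (Hloc y Hy); apply filter_imp; exact IH. }
  intros Hx; destruct n as [| [| n]]; [exact I | |].
  - eexists; now apply is_derive_ln_Rabs.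
  - destruct (H n) as [c Hc].
    apply ex_derive_ext_loc with (fun t => c * / t ^ S n).
    + generalize (Hloc x Hx); apply filter_imp; intros y Hy; symmetry; auto.
    + auto_derive; now apply (pow_nonzero x (S n)).
Qed.

(** * Angles on the rotational surface *)

Lemma pscal_non_isotropic (p q : vec) :
  ~ isotropic q -> pscal p q = cx p * cx q - cy p * cy q.
Proof.
  unfold pscal; intros Hq.
  destruct (isotropic_dec p), (isotropic_dec q); tauto.
Qed.

(* [A] and [B] are the components of [p] along the meridian and the parallel. *)
Lemma is_angle_meridian_iff (p q : vec) (A B w eta : R) :
  0 <= eta ->
  cx p = A * sinh w + B * cosh w -> cy p = A * cosh w + B * sinh w ->
  cx q = sinh w -> cy q = cosh w ->
  (is_angle p q eta <-> B <> 0 /\ Rabs A * cosh eta = Rabs B * sinh eta) /\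
  (is_angle p q eta ->
     pnorm p * sinh eta = Rabs A /\ pnorm p * cosh eta = Rabs B).
Proof.
  intros Heta px py qx qy.
  pose proof (cosh2_sinh2 w) as Hw.
  pose proof (cosh2_sinh2 eta) as He.
  pose proof (cosh_pos eta) as Hc.
  pose proof (sinh_nonneg eta Heta) as Hs.
  assert (Hq : ~ isotropic q).
  { intros [_ E]; pose proof (cosh_pos w); lra. }
  assert (Hqq : pscal q q = -1).
  { rewrite pscal_non_isotropic, qx, qy by exact Hq; lra. }
  assert (Hpq : pscal p q = - A).
  { rewrite pscal_non_isotropic, px, py, qx, qy by exact Hq.
    transitivity (A * (sinh w * sinh w - cosh w * cosh w)); [ring |].
    rewrite Hw; ring. }
  assert (Hnq : pnorm q = 1).
  { unfold pnorm; rewrite Hqq, Rabs_left by lra.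
    replace (- -1) with 1 by ring; apply sqrt_1. }
  assert (Hcxy : cx p * cx p - cy p * cy p = B * B - A * A).
  { rewrite px, py.
    transitivity ((B * B - A * A) * (cosh w * cosh w - sinh w * sinh w));
      [ring |].
    rewrite Hw; ring. }
  assert (Hpp : ~ isotropic p -> pscal p p = B * B - A * A).
  { intros Hp; now rewrite pscal_non_isotropic. }
  assert (Hfwd : is_angle p q eta ->
     0 < B * B - A * A /\
     pnorm p * sinh eta = Rabs A /\ pnorm p * cosh eta = Rabs B).
  { intros (Sp & Np & _ & _ & E).
    specialize (Hpp Np).
    assert (P : 0 < B * B - A * A).
    { destruct Sp as [-> | [_ P]]; [| lra].
      destruct Np; split; reflexivity. }
    rewrite Hpq, Hnq, Rabs_Ropp in E.
    assert (N0 : 0 <= pnorm p) by apply sqrt_pos.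
    assert (N2 : pnorm p * pnorm p = B * B - A * A).
    { unfold pnorm; rewrite sqrt_sqrt by apply Rabs_pos.
      rewrite Hpp; apply Rabs_right; lra. }
    split; [exact P |]; split; [lra |].
    (* Squares are compared: [|p|^2 cosh^2 eta = |p|^2 + |p|^2 sinh^2 eta = (B^2 - A^2) + A^2 =
       B^2]. *)
    apply Rsqr_inj; [apply Rmult_le_pos; lra | apply Rabs_pos |].
    rewrite <- Rsqr_abs.
    assert (EA : A * A = Rabs A * Rabs A) by exact (Rsqr_abs A).
    unfold Rsqr.
    transitivity (pnorm p * pnorm p * (cosh eta * cosh eta)); [ring |].
    rewrite He.
    transitivity (pnorm p * pnorm p
                  + (pnorm p * 1 * sinh eta) * (pnorm p * 1 * sinh eta));
      [ring |].
    rewrite <- E, N2, <- EA; ring. }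
  split; [split |]; [| | intros H; apply Hfwd, H].
  - intros H; destruct (Hfwd H) as (P & E1 & E2).
    split; [intros ->; nra |].
    rewrite <- E1, <- E2; ring.
  - intros [HB E].
    assert (E2 : (A * A) * (cosh eta * cosh eta)
                 = (B * B) * (sinh eta * sinh eta)).
    { change (A * A) with (Rsqr A); change (B * B) with (Rsqr B).
      rewrite (Rsqr_abs A), (Rsqr_abs B); unfold Rsqr.
      transitivity ((Rabs A * cosh eta) * (Rabs A * cosh eta)); [ring |].
      rewrite E; ring. }
    assert (BB : 0 < B * B) by (apply Rsqr_pos_lt in HB; exact HB).
    (* Since [A^2 cosh^2 eta = B^2 sinh^2 eta], this product is [B^2 (cosh^2 eta - sinh^2 eta)]; its
       positivity shows that [p] is space-like. *)
    assert (EA : (B * B - A * A) * (cosh eta * cosh eta) = B * B).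
    { rewrite Rmult_minus_distr_r, E2, He; ring. }
    assert (P : 0 < B * B - A * A).
    { apply Rmult_lt_reg_r with (cosh eta * cosh eta); nra. }
    assert (Np : ~ isotropic p).
    { intros [X Y]; rewrite X, Y in Hcxy; lra. }
    specialize (Hpp Np).
    split; [right; split; trivial; lra |].
    split; [exact Np |]; split; [split; trivial; lra |].
    split; [exact Heta |].
    rewrite Hpq, Hnq, Rabs_Ropp.
    assert (N0 : 0 <= pnorm p) by apply sqrt_pos.
    assert (N2 : pnorm p * pnorm p = B * B - A * A).
    { unfold pnorm; rewrite sqrt_sqrt by apply Rabs_pos.
      rewrite Hpp; apply Rabs_right; lra. }
    apply Rsqr_inj; [apply Rabs_pos | nra |].
    rewrite <- Rsqr_abs; unfold Rsqr.
    transitivity ((pnorm p * pnorm p) * (sinh eta * sinh eta)); [| ring].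
    rewrite N2, Rmult_minus_distr_r, <- E2, He; ring.
Qed.

(** The product rule gives the first two components of [g'] as [u' (sinh v, cosh v) + u v' (cosh v,
    sinh v)], so the previous lemma applies with [A = u'], [B = u v'] and [w = v]. *)
Lemma is_angle_R2_iff (f u v : R -> R) (g : R -> vec) (eta t : R) :
  0 <= eta -> ex_derive u t -> ex_derive v t ->
  locally t (fun s => g s = R2 f (u s) (v s)) ->
  let q := velocity (meridian f (v t)) (u t) in
  (is_angle (velocity g t) q eta <->
     u t * Derive v t <> 0 /\
     Rabs (Derive u t) * cosh eta = Rabs (u t * Derive v t) * sinh eta) /\
  (is_angle (velocity g t) q eta ->
     pnorm (velocity g t) * sinh eta = Rabs (Derive u t) /\
     pnorm (velocity g t) * cosh eta = Rabs (u t * Derive v t)).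
Proof.
  intros Heta Hu Hv Hg q.
  apply is_angle_meridian_iff with (v t); trivial; unfold q, velocity;
    cbn [cx cy fst snd].
  - rewrite (Derive_ext_loc _ (fun s => u s * sinh (v s))).
    + apply is_derive_unique; auto_derive; [tauto |].
      change (fun x => u x) with u; change (fun x => v x) with v; ring.
    + revert Hg; apply filter_imp; intros s ->; reflexivity.
  - rewrite (Derive_ext_loc _ (fun s => u s * cosh (v s))).
    + apply is_derive_unique; auto_derive; [tauto |].
      change (fun x => u x) with u; change (fun x => v x) with v; ring.
    + revert Hg; apply filter_imp; intros s ->; reflexivity.
  - apply is_derive_unique; unfold meridian, R2, cx; simpl.
    auto_derive; [trivial | ring].
  - apply is_derive_unique; unfold meridian, R2, cy; simpl.
    auto_derive; [trivial | ring].
Qed.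

Lemma spacelike_loxodrome_intro (f u v : R -> R) (eta : R) (a b : Rbar)
    (g : R -> vec) :
  0 <= eta -> smooth_on a b u -> smooth_on a b v ->
  (forall t, in_ival a b t -> g t = R2 f (u t) (v t)) ->
  (forall t, in_ival a b t ->
     u t * Derive v t <> 0 /\
     Rabs (Derive u t) * cosh eta = Rabs (u t * Derive v t) * sinh eta) ->
  spacelike_loxodrome f eta a b g.
Proof.
  intros Heta Hu Hv Hg HE.
  assert (Ha : forall t, in_ival a b t ->
     is_angle (velocity g t) (velocity (meridian f (v t)) (u t)) eta).
  { intros t Ht.
    apply (is_angle_R2_iff f u v g eta t Heta);
      [now apply smooth_on_ex_derive with a b
      | now apply smooth_on_ex_derive with a b | | now apply HE].
    generalize (in_ival_locally a b t Ht); apply filter_imp; exact Hg. }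
  split.
  (* Space-likeness of the velocity is part of [is_angle]. *)
  - intros t Ht; apply (Ha t Ht).
  - exists u, v; auto.
Qed.

Lemma spacelike_loxodrome_elim (f : R -> R) (eta : R) (a b : Rbar)
    (g : R -> vec) :
  0 <= eta -> spacelike_loxodrome f eta a b g ->
  exists u v : R -> R,
    smooth_on a b u /\ smooth_on a b v /\
    forall t, in_ival a b t ->
      g t = R2 f (u t) (v t) /\ u t * Derive v t <> 0 /\
      pnorm (velocity g t) * sinh eta = Rabs (Derive u t) /\
      pnorm (velocity g t) * cosh eta = Rabs (u t * Derive v t).
Proof.
  intros Heta [_ (u & v & Hu & Hv & Hg & Ha)].
  exists u, v; split; [exact Hu |]; split; [exact Hv |]; intros t Ht.
  destruct (is_angle_R2_iff f u v g eta t Heta) as [H1 H2].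
  - now apply smooth_on_ex_derive with a b.
  - now apply smooth_on_ex_derive with a b.
  - generalize (in_ival_locally a b t Ht); apply filter_imp; exact Hg.
  - split; [now apply Hg |]; split; [now apply H1, Ha | now apply H2, Ha].
Qed.

(** * The two families of loxodromes *)

Lemma gamma3_R2 (f : R -> R) (eta e1 e2 t : R) :
  gamma3 f eta e1 e2 t =
  R2 f (e1 * t * sinh eta) (e2 * coth eta * ln (Rabs t)).
Proof. reflexivity. Qed.

Lemma Rabs_sign (e : R) : is_sign e -> Rabs e = 1.
Proof.
  intros [-> | ->]; [apply Rabs_R1 | rewrite Rabs_left; lra].
Qed.

(** Here [u' = e1 sinh eta] and [u v' = e1 e2 cosh eta], so both sides of the angle equation equal
    [sinh eta cosh eta]. The interval avoids 0, where [ln |t|] is singular. *)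
Lemma gamma3_spacelike_loxodrome (f : R -> R) (eta e1 e2 : R) (a b : Rbar) :
  0 < eta -> is_sign e1 -> is_sign e2 -> ~ in_ival a b 0 ->
  spacelike_loxodrome f eta a b (gamma3 f eta e1 e2).
Proof.
  intros Heta He1 He2 H0.
  assert (Hs : 0 < sinh eta) by now apply sinh_pos.
  pose proof (cosh_pos eta) as Hc.
  assert (Hnz : forall t, in_ival a b t -> t <> 0) by now intros t Ht ->.
  apply spacelike_loxodrome_intro
    with (fun t => e1 * t * sinh eta) (fun t => e2 * coth eta * ln (Rabs t)).
  - lra.
  - intros n t _; apply ex_derive_n_scal_r, ex_derive_n_scal_l.
    apply ex_derive_n_id.
  - intros n t Ht; apply ex_derive_n_scal_l, ex_derive_n_ln_Rabs; auto.
  - reflexivity.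
  - intros t Ht; pose proof (Hnz t Ht) as Ht0.
    assert (Du : Derive (fun s => e1 * s * sinh eta) t = e1 * sinh eta).
    { apply is_derive_unique; auto_derive; [trivial | ring]. }
    assert (Dv : e1 * t * sinh eta
                 * Derive (fun s => e2 * coth eta * ln (Rabs s)) t
                 = e1 * e2 * cosh eta).
    { rewrite Derive_scal, Derive_ln_Rabs by exact Ht0.
      unfold coth; field; lra. }
    rewrite Du, Dv, !Rabs_mult, (Rabs_sign e1), (Rabs_sign e2) by assumption.
    rewrite (Rabs_right (sinh eta)), (Rabs_right (cosh eta)) by lra.
    split; [| ring].
    assert (e1 <> 0) by (destruct He1; lra).
    assert (e2 <> 0) by (destruct He2; lra).
    apply Rmult_integral_contrapositive_currified; [| lra].
    now apply Rmult_integral_contrapositive_currified.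
Qed.

Lemma spacelike_loxodrome_gamma3 (f : R -> R) (eta : R) (a b : Rbar)
    (g : R -> vec) :
  0 < eta -> Rbar_lt a b -> spacelike_loxodrome f eta a b g ->
  exists (e1 e2 c : R) (phi : R -> R),
    is_sign e1 /\ is_sign e2 /\ arclength a b g phi /\
    (forall t, in_ival a b t ->
       phi t <> 0 /\ g t = hyp_rot c (gamma3 f eta e1 e2 (phi t))).
Proof.
  intros Heta Hab Hg.
  assert (Hs : 0 < sinh eta) by now apply sinh_pos.
  pose proof (cosh_pos eta) as Hc.
  apply spacelike_loxodrome_elim in Hg; [| lra].
  destruct Hg as (u & v & Hu & Hv & H).
  assert (Hu0 : forall t, in_ival a b t -> u t <> 0).
  { intros t Ht E; destruct (H t Ht) as (_ & N & _); rewrite E in N; lra. }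
  (* If [u' = 0], then [|g'| sinh eta = 0] forces [|g'| = 0], and [|g'| cosh eta = |u v'|]
     contradicts [u v' <> 0]. *)
  assert (Hdu0 : forall t, in_ival a b t -> Derive u t <> 0).
  { intros t Ht E; destruct (H t Ht) as (_ & N & E1 & E2).
    apply Rabs_pos_lt in N; rewrite E, Rabs_R0 in E1.
    assert (pnorm (velocity g t) = 0) by nra; nra. }
  (* The product has the sign of the quotient [u v' / u'], whose absolute value is [coth eta]. *)
  destruct (nonvanishing_sign a b (fun t => Derive u t * (u t * Derive v t)))
    as (e2 & He2 & Hsgn); [exact Hab | |].
  { intros t Ht; split.
    - apply (continuity_pt_mult (Derive u) (fun s => u s * Derive v s));
        [| apply (continuity_pt_mult u (Derive v))].
      + now apply smooth_on_continuity_Derive with a b.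
      + apply continuity_pt_filterlim, (ex_derive_continuous u).
        now apply smooth_on_ex_derive with a b.
      + now apply smooth_on_continuity_Derive with a b.
    - apply Rmult_integral_contrapositive_currified; [now apply Hdu0 |].
      now apply H. }
  (* Eliminating [|g'|] leaves [|u v'| sinh eta = |u'| cosh eta]; the constant sign [e2] removes the
     absolute values. *)
  assert (Hode : forall t, in_ival a b t ->
             u t * Derive v t = e2 * coth eta * Derive u t).
  { intros t Ht; destruct (H t Ht) as (_ & _ & E1 & E2).
    specialize (Hsgn t Ht).
    unfold coth; apply Rmult_eq_reg_r with (sinh eta); [| lra].
    transitivity (e2 * cosh eta * Derive u t); [| field; lra].
    assert (E : Rabs (u t * Derive v t) * sinh eta
                = Rabs (Derive u t) * cosh eta) by (rewrite <- E1, <- E2; ring).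
    revert E Hsgn.
    generalize (u t * Derive v t); generalize (Derive u t); intros A B E P.
    unfold Rabs in E.
    destruct He2 as [-> | ->], (Rcase_abs A), (Rcase_abs B); nra. }
  (* Chosen so that [u = phi sinh eta]; then [|phi'| = |u'| / sinh eta = |g'|]. *)
  pose (phi := fun t => u t * / sinh eta).
  assert (Hphi0 : forall t, in_ival a b t -> phi t <> 0).
  { intros t Ht; apply Rmult_integral_contrapositive_currified;
      [now apply Hu0 | apply Rinv_neq_0_compat; lra]. }
  assert (Hdphi : forall t, in_ival a b t ->
             is_derive phi t (Derive u t * / sinh eta)).
  { intros t Ht; unfold phi; auto_derive.
    - now apply smooth_on_ex_derive with a b.
    - change (fun x => u x) with u; ring. }
  (* The integration constant of the equation [Hode]: as [phi' / phi = u' / u], its derivative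
     vanishes. *)
  pose (h := fun t => v t - e2 * coth eta * ln (Rabs (phi t))).
  assert (Hdh : forall t, in_ival a b t -> is_derive h t 0).
  { intros t Ht.
    replace 0 with (Derive v t
      - e2 * coth eta * (Derive u t * / sinh eta * / phi t)).
    - apply (is_derive_minus v (fun t => e2 * coth eta * ln (Rabs (phi t)))).
      + now apply Derive_correct, smooth_on_ex_derive with a b.
      + apply (is_derive_scal (fun t => ln (Rabs (phi t)))).
        apply (is_derive_comp (fun t => ln (Rabs t)) phi);
          [now apply is_derive_ln_Rabs, Hphi0 | now apply Hdphi].
    - pose proof (Hu0 t Ht) as Ut; unfold phi.
      apply Rmult_eq_reg_l with (u t); [| exact Ut].
      rewrite Rmult_minus_distr_l, Hode by exact Ht.
      field; lra. }
  destruct (in_ival_nonempty a b Hab) as [t0 Ht0].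
  (* The sign [e1 = 1] suffices because [phi] takes the sign of [u]. *)
  exists 1, e2, (h t0), phi.
  split; [now left |]; split; [exact He2 |]; split; [split |].
  - intros n t Ht; apply ex_derive_n_scal_r, Hu, Ht.
  - intros t Ht; rewrite (is_derive_unique _ _ _ (Hdphi t Ht)).
    assert (0 < / sinh eta) by now apply Rinv_0_lt_compat.
    split.
    + apply Rmult_integral_contrapositive_currified; [now apply Hdu0 | lra].
    + destruct (H t Ht) as (_ & _ & E1 & _).
      rewrite Rabs_mult, (Rabs_right (/ sinh eta)), <- E1 by lra.
      field; lra.
  - intros t Ht; split; [now apply Hphi0 |].
    rewrite gamma3_R2, hyp_rot_R2.
    rewrite (is_derive_zero_constant a b h t0 t Hdh Ht0 Ht).
    rewrite (proj1 (H t Ht)); f_equal.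
    + unfold phi; field; lra.
    + unfold h; ring.
Qed.

(** With [u' = 0], [u v' = 1] and [sinh 0 = 0], both sides of the angle equation vanish. *)
Lemma parallel_spacelike_loxodrome (f : R -> R) (u0 : R) (a b : Rbar) :
  u0 <> 0 -> spacelike_loxodrome f 0 a b (parallel f u0).
Proof.
  intros Hu0.
  apply spacelike_loxodrome_intro with (fun _ => u0) (fun t => t * / u0).
  - lra.
  - intros n t _; apply ex_derive_n_const.
  - intros n t _; apply ex_derive_n_scal_r, ex_derive_n_id.
  - reflexivity.
  - intros t _.
    rewrite Derive_const, Rabs_R0, sinh_0.
    replace (Derive (fun s => s * / u0) t) with (/ u0).
    + rewrite Rinv_r by exact Hu0; split; lra.
    + symmetry; apply is_derive_unique; auto_derive; [trivial | ring].
Qed.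

Lemma spacelike_loxodrome_parallel (f : R -> R) (a b : Rbar) (g : R -> vec) :
  Rbar_lt a b -> spacelike_loxodrome f 0 a b g ->
  exists (u0 : R) (phi : R -> R),
    u0 <> 0 /\ arclength a b g phi /\
    (forall t, in_ival a b t -> g t = parallel f u0 (phi t)).
Proof.
  intros Hab Hg.
  apply spacelike_loxodrome_elim in Hg; [| lra].
  destruct Hg as (u & v & Hu & Hv & H).
  rewrite sinh_0, cosh_0 in H.
  destruct (in_ival_nonempty a b Hab) as [t0 Ht0].
  (* For [eta = 0] the relation [|g'| sinh eta = |u'|] reads [u' = 0]. *)
  assert (Hconst : forall t, in_ival a b t -> u t = u t0).
  { intros t Ht; apply (is_derive_zero_constant a b u); trivial.
    intros s Hs.
    replace 0 with (Derive u s).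
    - now apply Derive_correct, smooth_on_ex_derive with a b.
    - destruct (H s Hs) as (_ & _ & E & _).
      apply Rabs_eq_0; lra. }
  assert (Hu0 : u t0 <> 0).
  { intros E; destruct (H t0 Ht0) as (_ & N & _); rewrite E in N; lra. }
  (* The parallel takes the angle [phi / u0], which is exactly [v]; a rotation would only shift
     [phi] by a constant. *)
  exists (u t0), (fun t => u t0 * v t).
  split; [exact Hu0 |]; split; [split |].
  - intros n t Ht; apply ex_derive_n_scal_l, Hv, Ht.
  - intros t Ht; destruct (H t Ht) as (_ & N & _ & E).
    rewrite (Hconst t Ht) in N, E.
    rewrite Derive_scal; split; [exact N | lra].
  - intros t Ht; destruct (H t Ht) as (E & _).
    rewrite E, (Hconst t Ht); unfold parallel; f_equal.
    field; exact Hu0.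
Qed.

(** Hyperbolic rotations permute the meridians and preserve the scalar product, and a regular change
    of parameter preserves the angle. Hence for [eta > 0] the converse determines a loxodrome up to
    a rotation [c] and a parameter [phi]. *)
Theorem theorem3p3 (f : R -> R) (hf : smooth f) (eta : R) (heta : 0 <= eta) :
  (0 < eta ->
     (forall (e1 e2 : R) (a b : Rbar),
        is_sign e1 -> is_sign e2 -> Rbar_lt a b -> ~ in_ival a b 0 ->
        spacelike_loxodrome f eta a b (gamma3 f eta e1 e2)) /\
     (forall (a b : Rbar) (g : R -> vec),
        Rbar_lt a b -> spacelike_loxodrome f eta a b g ->
        exists (e1 e2 c : R) (phi : R -> R),
          is_sign e1 /\ is_sign e2 /\ arclength a b g phi /\
          (forall t, in_ival a b t ->
             phi t <> 0 /\ g t = hyp_rot c (gamma3 f eta e1 e2 (phi t))))) /\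
  (eta = 0 ->
     (forall (u0 : R) (a b : Rbar),
        u0 <> 0 -> Rbar_lt a b ->
        spacelike_loxodrome f eta a b (parallel f u0)) /\
     (forall (a b : Rbar) (g : R -> vec),
        Rbar_lt a b -> spacelike_loxodrome f eta a b g ->
        exists (u0 : R) (phi : R -> R),
          u0 <> 0 /\ arclength a b g phi /\
          (forall t, in_ival a b t -> g t = parallel f u0 (phi t)))).
Proof.
  split.
  - intros Hpos; split.
    + intros e1 e2 a b He1 He2 _; now apply gamma3_spacelike_loxodrome.
    + intros a b g; now apply spacelike_loxodrome_gamma3.
  - intros ->; split.
    + intros u0 a b Hu0 _; now apply parallel_spacelike_loxodrome.
    + intros a b g; apply spacelike_loxodrome_parallel.
Qed.
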